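(* There exists an absolute constant $c>0$ such that for every positive integer $n$ there exists a graph $G_n$ on $n$ vertices with $\alpha(G_n)\le 2$ and $n_{\ge 0}(G_n)\ge c\, n^{1/9}$.
   Context: All graphs are finite and simple. $\alpha(G)$ denotes the independence number of $G$. A weighted adjacency matrix of a graph $G=(V,E)$ is a Hermitian matrix $A$ with rows and columns indexed by $V$ such that $A_{ij}\neq 0$ only if $ij\in E$ (in particular the diagonal is zero). For a Hermitian matrix $X$, $n_{\ge 0}(X)$ is the number of nonnegative eigenvalues of $X$ (with multiplicity). The (weighted) inertia $n_{\ge 0}(G)$ is the minimum of $n_{\ge 0}(A)$ over all weighted adjacency matrices $A$ of $G$. *)

(* Defs.v *)
From HB Require Import structures.
From mathcomp Require Import all_boot all_order all_algebra all_field.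
From mathcomp Require Import boolp complex Rstruct.
From Stdlib Require Import Reals.
Set Implicit Arguments. Unset Strict Implicit. Unset Printing Implicit Defensive.
Import Order.TTheory GRing.Theory Num.Theory.
Local Open Scope ring_scope.

Definition C := (Rdefinitions.R)[i].

Definition simple_graph (n : nat) (e : rel 'I_n) : Prop :=
  symmetric e /\ irreflexive e.

Definition independent (n : nat) (e : rel 'I_n) (S : {set 'I_n}) : bool :=
  [forall x in S, forall y in S, ~~ e x y].

Definition alpha (n : nat) (e : rel 'I_n) : nat :=
  \max_(S : {set 'I_n} | independent e S) #|S|.

Definition hermitian (n : nat) (A : 'M[C]_n) : Prop :=
  A = (map_mx Num.conj A)^T.

Definition weighted_adj (n : nat) (e : rel 'I_n) (A : 'M[C]_n) : Prop :=
  hermitian A /\ forall i j, A i j != 0 -> e i j.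

Definition eigenvalues (n : nat) (A : 'M[C]_n) : seq C :=
  sval (closed_field_poly_normal (char_poly A)).

Definition n_ge0_mx (n : nat) (A : 'M[C]_n) : nat :=
  count (fun z : C => 0 <= z) (eigenvalues A).

Lemma n_ge0_graph_ex (n : nat) (e : rel 'I_n) :
  exists k, `[< exists A, weighted_adj e A /\ n_ge0_mx A = k >].
Proof.
exists (n_ge0_mx (0 : 'M[C]_n)); apply/asboolP; exists 0; split=> //.
split; first by apply/matrixP=> i j; rewrite !mxE rmorph0.
by move=> i j; rewrite mxE eqxx.
Qed.

Definition n_ge0_graph (n : nat) (e : rel 'I_n) : nat := ex_minn (n_ge0_graph_ex e).

(* Main.v *)
Require Import Defs.
From mathcomp Require Import all_boot all_order all_algebra all_field.
From mathcomp Require Import boolp reals complex Rstruct.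
From mathcomp Require Import ring lra zify.
Set Implicit Arguments. Unset Strict Implicit. Unset Printing Implicit Defensive.
Import Order.TTheory GRing.Theory Num.Theory.

(* G is the complement of a triangle-free graph H on n vertices whose adjacency
   matrix is r-close in operator norm to J / r^2, where r^4 = O(n): over the field
   with q = r^2 elements join (a, b) and (c, d) when b + d = ac, and keep only the
   points where 2b - a^2 lies in a fixed nonsquare class.

   Let A be a weighted adjacency matrix of G with k nonnegative eigenvalues.  After
   a congruence by a positive diagonal matrix, |A| has nearly constant diagonal, up
   to at most k exceptional rows.  Write A = P - N with P, N >= 0 and PN = 0.  Then
   P and N agree on the diagonal and on the edges of H, so sum_H |P_ij|^2 =
   sum_H N_ij P_ji.  As H is close to J / q and the Schur product of positive
   semidefinite matrices is positive semidefinite, the left side is at least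
   tr(P^2) / q - r sum_i P_ii^2, and the right side is at most
   tr(NP) / q + r sum_i P_ii^2 = r sum_i P_ii^2.  Since tr(P)^2 <= k tr(P^2) and
   the P_ii are balanced, n = O(r^3 k) = O(n^(3/4) k), which even gives the
   exponent 1/4. *)

Local Open Scope ring_scope.

(** * A pseudorandom triangle-free graph *)

(* If u, v, w are pairwise polar, the product of their values of 2b - a^2 is the
   square of (a - c)(a - g)(c - g). *)
Lemma polar_nonsquare_product (R : fieldType) (a b c d g f e x y z : R) :
  (forall t, e != t ^+ 2) -> x != 0 -> y != 0 -> z != 0 ->
  b *+ 2 - a ^+ 2 = e * x ^+ 2 -> d *+ 2 - c ^+ 2 = e * y ^+ 2 ->
  f *+ 2 - g ^+ 2 = e * z ^+ 2 ->
  b + d = a * c -> d + f = c * g -> b + f = a * g -> False.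
Proof.
move=> ns x0 y0 z0 Qx Qy Qz uv vw uw.
have Q1 : e * x ^+ 2 = - ((a - c) * (a - g)).
  rewrite -Qx (_ : b *+ 2 = (b + d) + (b + f) - (d + f)); last by ring.
  by rewrite uv uw vw; ring.
have Q2 : e * y ^+ 2 = - ((c - a) * (c - g)).
  rewrite -Qy (_ : d *+ 2 = (b + d) + (d + f) - (b + f)); last by ring.
  by rewrite uv uw vw; ring.
have Q3 : e * z ^+ 2 = - ((g - a) * (g - c)).
  rewrite -Qz (_ : f *+ 2 = (b + f) + (d + f) - (b + d)); last by ring.
  by rewrite uv uw vw; ring.
have e0 : e != 0 by have := ns 0; rewrite expr0n.
have nz : e * x * y * z != 0 by rewrite !mulf_neq0.
pose D := (a - c) * (a - g) * (c - g).
have E : e * (e * x * y * z) ^+ 2 = D ^+ 2.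
  have -> : e * (e * x * y * z) ^+ 2
    = (e * x ^+ 2) * (e * y ^+ 2) * (e * z ^+ 2) by ring.
  by rewrite Q1 Q2 Q3 /D; ring.
move: (ns (D / (e * x * y * z))); rewrite expr_div_n -E.
by rewrite mulfK ?eqxx // expf_neq0.
Qed.

Lemma slope_eq (R : fieldType) (a b c d x : R) : a != c ->
  (x * a - b == x * c - d) = (x == (b - d) / (a - c)).
Proof.
rewrite -subr_eq0 => ac; rewrite -subr_eq0.
have -> : x * a - b - (x * c - d) = x * (a - c) - (b - d) by ring.
by rewrite subr_eq0; apply/eqP/eqP => [<-|->]; rewrite ?mulfK ?divfK.
Qed.

Section PolarityGraph.
Variable F : finFieldType.

Definition polar (u v : F * F) : bool := u.2 + v.2 == u.1 * v.1.

Lemma polar_sym : symmetric polar.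
Proof. by move=> u v; rewrite /polar addrC mulrC. Qed.

(** The coset of the nonzero squares that contains [e]; for a nonsquare [e] it consists of all
    nonsquares. *)
Definition twisted_sq (e : F) : {set F} := [set e * t ^+ 2 | t in [set~ 0]].

Definition polar_half (e : F) : {set F * F} :=
  [set u | u.2 *+ 2 - u.1 ^+ 2 \in twisted_sq e].

(** A loop at (a, b) means 2b = a^2, and 0 is not in the coset of [e]. *)
Lemma polar_half_irr (e : F) u : u \in polar_half e -> e != 0 -> ~~ polar u u.
Proof.
rewrite inE => /imsetP[t]; rewrite !inE => t0 Q e0; apply/eqP => uu.
have : e * t ^+ 2 = 0 by rewrite -Q mulr2n uu expr2 subrr.
by move/eqP; rewrite mulf_eq0 expf_eq0 (negPf e0) (negPf t0).
Qed.

Lemma polar_half_triangle_free e u v w : (forall t, e != t ^+ 2) ->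
  u \in polar_half e -> v \in polar_half e -> w \in polar_half e ->
  polar u v -> polar v w -> polar u w -> False.
Proof.
case: u v w => [a b] [c d] [g f] ns.
rewrite !inE /polar /= => /imsetP[x]; rewrite !inE => x0 Qx.
move=> /imsetP[y]; rewrite !inE => y0 Qy /imsetP[z]; rewrite !inE => z0 Qz.
move=> /eqP uv /eqP vw /eqP uw.
apply: (@polar_nonsquare_product F a b c d g f e x y z) => //.
Qed.

Hypothesis two_neq0 : 2%:R != 0 :> F.

(** If every element were a square, squaring would be a bijection of the finite field, yet it
    identifies 1 with -1. *)
Lemma nonsquare_exists : exists e : F, forall t, e != t ^+ 2.
Proof.
apply/not_existsP => H.
have surj : forall e : F, exists t, e == t ^+ 2.
  move=> e; apply: contrapT => /forallNP Ne; apply: (H e) => t.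
  by apply/negP.
pose g (e : F) := xchoose (surj e).
have gK : cancel g (fun t => t ^+ 2).
  by move=> e; rewrite -(eqP (xchooseP (surj e))).
have g_inj := can_inj gK.
have [h gh hg] := injF_bij g_inj.
have : (1 : F) = -1.
  have E t : h t = t ^+ 2 by rewrite -{1}(hg t) gh -{2}(hg t) gK.
  by apply: (can_inj hg); rewrite !E sqrrN.
move/eqP; rewrite -subr_eq0 opprK -[1 + 1]/(2%:R) => /eqP h2.
by move: two_neq0; rewrite h2 eqxx.
Qed.

(** On nonzero elements the map t -> e t^2 has fibres inside {t, -t}. *)
Lemma card_twisted_sq (e : F) : e != 0 -> (#|F| <= (#|twisted_sq e|).*2.+1)%N.
Proof.
move=> e0.
have cF : #|[set~ (0 : F)]| = #|F|.-1 by rewrite cardsC1.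
have : (#|[set~ (0%R : F)]| <= (#|twisted_sq e|).*2)%N.
  rewrite -sum1_card (partition_big_imset (fun t : F => e * t ^+ 2)) /=.
  rewrite -muln2 -sum_nat_const leq_sum // => y yin.
  rewrite sum1dep_card.
  have /imsetP [t _ yE] := yin.
  apply: leq_trans (_ : #|[set t; - t]| <= _)%N; last by rewrite cards2; case: eqP.
  apply: subset_leq_card; apply/fintype.subsetP => z; rewrite !inE => /andP[_ /eqP].
  rewrite yE => /(mulfI e0) /eqP; rewrite -subr_eq0 subr_sqr mulf_eq0.
  by rewrite subr_eq0 addr_eq0.
by rewrite cF; case: #|F|.
Qed.

Lemma card_polar_half (e : F) : (#|F| * #|twisted_sq e| <= #|polar_half e|)%N.
Proof.
pose f (x : F * F) := (x.1, (x.1 ^+ 2 + x.2) / 2%:R).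
have f_inj : injective f.
  move=> [a y] [c z] /= [<- E].
  by have /addrI -> := mulIf (invr_neq0 two_neq0) E.
have -> : (#|F| * #|twisted_sq e|)%N = #|setX [set: F] (twisted_sq e)|.
  by rewrite cardsX cardsT.
rewrite -(card_imset _ f_inj); apply: subset_leq_card; apply/fintype.subsetP => u.
move=> /imsetP[[a y]]; rewrite !inE /= => y_in ->; rewrite /= -[X in X - _]mulr_natr.
by rewrite divfK // addrAC subrr add0r.
Qed.

End PolarityGraph.

(** * Comparison of the polarity graph with J / q as quadratic forms *)

Section QuadraticForm.
Variables (F : finFieldType) (K : numClosedFieldType) (r : nat).
Hypotheses (r_gt0 : (0 < r)%N) (cardF : #|F| = (r ^ 2)%N).
Local Notation q := (r%:R ^+ 2 : K).

Let polar_q (v u : F * F) : K := (polar v u)%:R - q^-1.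

Let q_neq0 : q != 0. Proof. by rewrite expf_neq0 // pnatr_eq0 -lt0n. Qed.

Lemma sum_polar (u : F * F) : \sum_v (polar v u)%:R = q :> K.
Proof.
rewrite -(pair_bigA _ (fun x y => (polar (x, y) u)%:R)) /=.
rewrite (eq_bigr (fun=> 1)) => [|x _].
  by rewrite sumr_const cardF natrX.
rewrite (bigD1 (x * u.1 - u.2)) //= big1 => [|y yn].
  by rewrite /polar /= subrK eqxx addr0.
by rewrite /polar /= eq_sym -subr_eq eq_sym (negPf yn).
Qed.

(** The neighbours of [u] form the line y = x * u.1 - u.2. Lines of different slopes meet once,
    distinct parallel lines never, and a line has q points. *)
Lemma sum_polar2 (u w : F * F) :
  \sum_v (polar v u)%:R * (polar v w)%:R
  = 1 + q *+ (u == w) - (u.1 == w.1)%:R :> K.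
Proof.
rewrite -(pair_bigA _ (fun x y => (polar (x, y) u)%:R * (polar (x, y) w)%:R)) /=.
rewrite (eq_bigr (fun x => (x * u.1 - u.2 == x * w.1 - w.2)%:R)) => [|x _].
  case: u w => [a b] [c d] /=; rewrite xpair_eqE.
  have [-> /=|/= ac] := eqVneq a c.
    under eq_bigr => x _ do rewrite (inj_eq (addrI _)) (inj_eq oppr_inj).
    by rewrite sumr_const cardF addrAC subrr add0r mulrb -natrX; case: eqP; rewrite ?mul0rn.
  rewrite mulr0n addr0 subr0 (bigD1 ((b - d) / (a - c))) //= big1 => [|x xn].
    by rewrite slope_eq // eqxx addr0.
  by rewrite slope_eq // (negPf xn).
rewrite (bigD1 (x * u.1 - u.2)) //= big1 => [|y yn].
  by rewrite /polar /= subrK eqxx addr0 mul1r eq_sym -subr_eq eq_sym.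
by rewrite /polar /= eq_sym -subr_eq eq_sym (negPf yn) mul0r.
Qed.

(** Centering contributes -1 - 1 + 1, which cancels the constant 1 of [sum_polar2]. *)
Lemma sum_polar_q2 u w :
  \sum_v polar_q v u * polar_q v w = q *+ (u == w) - (u.1 == w.1)%:R.
Proof.
transitivity (\sum_v ((polar v u)%:R * (polar v w)%:R - q^-1 * (polar v u)%:R
  - q^-1 * (polar v w)%:R + q^-1 * q^-1)).
  by apply: eq_bigr => v _; rewrite /polar_q; ring.
rewrite big_split /= !sumrB -!mulr_sumr !sum_polar sum_polar2 sumr_const.
rewrite card_prod cardF mulVf // -[X in _ + _ * X]mulr_natr natrM !natrX.
by field; rewrite pnatr_eq0 -lt0n.
Qed.

Variables (n : nat) (phi : 'I_n -> F * F).
Hypothesis phi_inj : injective phi.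
Implicit Types x : 'I_n -> K.

(** With B the centred matrix, B^* B is q I minus the matrix of equal slopes, and the latter is
    positive semidefinite. *)
Lemma polar_q_l2 x :
  \sum_v (\sum_j polar_q v (phi j) * x j)^* * (\sum_j polar_q v (phi j) * x j)
  <= q * \sum_i (x i)^* * x i.
Proof.
have conjP v u : (polar_q v u)^* = polar_q v u.
  by rewrite /polar_q rmorphB /= fmorphV rmorphXn /= !conjC_nat.
rewrite (eq_bigr (fun v => \sum_j \sum_l
   (polar_q v (phi j) * polar_q v (phi l)) * ((x j)^* * x l))); last first.
  move=> v _; rewrite rmorph_sum mulr_suml; apply: eq_bigr => j _.
  rewrite mulr_sumr; apply: eq_bigr => l _.
  by rewrite rmorphM /= conjP; ring.
rewrite exchange_big /=.
under eq_bigr => j _ do rewrite exchange_big /=.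
under eq_bigr => j _ do under eq_bigr => l _ do
  rewrite -mulr_suml sum_polar_q2 mulrBl.
under eq_bigr => j _ do rewrite sumrB.
rewrite sumrB lerBlDr mulr_sumr.
rewrite [X in X <= _](_ : _ = \sum_i q * ((x i)^* * x i)); last first.
  apply: eq_bigr => j _; rewrite (bigD1 j) //= eqxx big1 ?addr0 // => l lj.
  by rewrite (inj_eq phi_inj) eq_sym (negPf lj) mulr0n mul0r.
rewrite lerDl.
(* Grouping the points by slope [a] turns the equal-slope form into a sum of squared moduli. *)
rewrite [X in 0 <= X](_ : _ =
  \sum_a (\sum_(j | (phi j).1 == a) x j)^* * (\sum_(j | (phi j).1 == a) x j)).
  by apply: sumr_ge0 => a _; rewrite mulrC -normCK exprn_ge0.
transitivity (\sum_a \sum_j \sum_l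
  (((phi j).1 == a)%:R * ((phi l).1 == a)%:R) * ((x j)^* * x l)).
  rewrite [RHS]exchange_big /=; apply: eq_bigr => j _.
  rewrite [RHS]exchange_big /=; apply: eq_bigr => l _.
  rewrite -mulr_suml; congr (_ * _).
  rewrite (bigD1 (phi j).1) //= eqxx mul1r big1 ?addr0 1?eq_sym // => a an.
  by rewrite eq_sym (negPf an) mul0r.
apply: eq_bigr => a _; rewrite rmorph_sum mulr_suml [RHS]big_mkcond /=.
apply: eq_bigr => j _; case: eqP => _; last first.
  by rewrite big1 // => l _; rewrite !mul0r.
rewrite mulr_sumr [RHS]big_mkcond /=; apply: eq_bigr => l _; rewrite mul1r.
by case: eqP; rewrite ?mul1r ?mul0r.
Qed.

(** The bound |Bx|^2 <= q |x|^2 with q = r^2 gives both signs at once: expand |r x - e B x|^2 >= 0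
    with e = 1 or -1 and divide by 2r. *)
Lemma polar_q_form x (s : bool) :
  (-1) ^+ s * (\sum_i \sum_j ((polar (phi i) (phi j))%:R - q^-1) * ((x i)^* * x j))
  <= r%:R * \sum_i (x i)^* * x i.
Proof.
pose y v := \sum_j polar_q v (phi j) * x j.
set f := \sum_i _; set N := \sum_i _.
have fE : f = \sum_i (x i)^* * y (phi i).
  apply: eq_bigr => i _; rewrite mulr_sumr; apply: eq_bigr => j _.
  by rewrite /polar_q; ring.
have fJ : f = \sum_i (y (phi i))^* * x i.
  rewrite /f exchange_big /=; apply: eq_bigr => j _.
  rewrite /y rmorph_sum mulr_suml; apply: eq_bigr => i _.
  rewrite rmorphM /= /polar_q rmorphB /= fmorphV rmorphXn /= !conjC_nat.
  by rewrite polar_sym; ring.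
(* Restricting from all points of the plane to the image of [phi] only drops nonnegative terms. *)
have yN : \sum_i (y (phi i))^* * y (phi i) <= q * N.
  apply: le_trans (polar_q_l2 x); rewrite -/(y _).
  rewrite -(big_imset (fun v => (y v)^* * y v)) /=; last by move=> ? ? _ _; apply: phi_inj.
  rewrite [X in _ <= X](bigID (mem [set phi i | i in 'I_n])) /= lerDl.
  by apply: sumr_ge0 => v _; rewrite mulrC -normCK exprn_ge0.
pose e : K := (-1) ^+ s.
have eJ : e^* = e by rewrite /e rmorphXn rmorphN1.
have ee : e * e = 1 by rewrite -expr2 sqrr_sign.
have : 0 <= \sum_i (r%:R * x i - e * y (phi i))^* * (r%:R * x i - e * y (phi i)).
  by apply: sumr_ge0 => i _; rewrite mulrC -normCK exprn_ge0.
rewrite (eq_bigr (fun i => q * ((x i)^* * x i) - r%:R * e * ((x i)^* * y (phi i))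
   - r%:R * e * ((y (phi i))^* * x i) + (y (phi i))^* * y (phi i))); last first.
  move=> i _; rewrite rmorphB !rmorphM /= eJ conjC_nat.
  rewrite -[X in _ = _ + X]mul1r -ee; ring.
rewrite big_split /= !sumrB -!mulr_sumr -fE -fJ -/N => H.
have {H} : 0 <= q * N - r%:R * e * f - r%:R * e * f + q * N.
  by apply: le_trans H _; rewrite lerD2l.
have -> : q * N - r%:R * e * f - r%:R * e * f + q * N
   = (2%:R * r%:R) * (r%:R * N - e * f) by ring.
by rewrite pmulr_rge0 ?subr_ge0 // mulr_gt0 ?ltr0n.
Qed.

End QuadraticForm.

(** The field has 9^m elements, so that r = 3^m is an integer with r^2 = q; any n points of
    [polar_half e] serve as vertices. *)
Lemma pseudorandom_triangle_free (K : numClosedFieldType) (n : nat) : (0 < n)%N ->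
  exists (r : nat) (H : rel 'I_n),
    [/\ (0 < r)%N, (r ^ 4 <= 324 * n)%N, symmetric H /\ irreflexive H,
        (forall i j l, H i j -> H j l -> H i l -> False)
      & forall (x : 'I_n -> K) (s : bool),
        (-1) ^+ s * (\sum_i \sum_j ((H i j)%:R - (r%:R ^+ 2)^-1) * ((x i)^* * x j))
        <= r%:R * \sum_i (x i)^* * x i].
Proof.
move=> n_gt0.
(* The condition 4n <= 81^m = q^2 leaves room for n points, and minimality of m gives r^4 = 81^m <
   81 * 4n = 324 n. *)
have ex_m : exists m, (4 * n <= 81 ^ m)%N.
  by exists (4 * n)%N; apply: ltnW; apply: ltn_expl.
case: (ex_minnP ex_m) => m Hm min_m.
have m_gt0 : (0 < m)%N by case: m Hm {min_m} => //; rewrite expn0; lia.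
have r4 : ((3 ^ m) ^ 4 = 81 ^ m)%N by rewrite -expnM mulnC expnM.
have m2_gt0 : (0 < m.*2)%N by rewrite double_gt0.
have [F chF cardF] := pPrimePowerField (isT : prime 3) m2_gt0.
have cF : #|F| = ((3 ^ m) ^ 2)%N by rewrite cardF -expnM muln2.
have two0 : 2%:R != 0 :> F.
  by rewrite -(dvdn_pcharf chF).
have [e ns] := nonsquare_exists two0.
have e0 : e != 0 by have := ns 0; rewrite expr0n.
have half_n : (n <= #|polar_half e|)%N.
  have := card_twisted_sq e0; have := card_polar_half two0 e.
  have q9 : (9 <= #|F|)%N by rewrite cF -expnM (@leq_exp2l 3 2) // muln2; lia.
  have : (4 * n <= #|F| * #|F|)%N by rewrite cF -expnD r4.
  set Y := #|twisted_sq e|; set S := #|polar_half e|; set Q := #|F| in q9 *.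
  (* Since q >= 9, the set has at least q (q - 1) / 2 >= q^2 / 4 >= n points. *)
  nia.
pose phi (i : 'I_n) : F * F := enum_val (widen_ord half_n i).
have phi_inj : injective phi.
  by move=> i j /enum_val_inj /(congr1 val) /= ij; apply: val_inj.
have phi_half i : phi i \in polar_half e by apply: enum_valP.
exists (3 ^ m)%N, (fun i j => polar (phi i) (phi j)); split.
- by rewrite expn_gt0.
- have : ~~ (4 * n <= 81 ^ m.-1)%N by apply/negP => /min_m; lia.
  by rewrite r4 -ltnNge -[in (81 ^ m)%N](prednK m_gt0) expnS; lia.
- split=> [i j|i]; first by rewrite polar_sym.
  by apply/negbTE/(polar_half_irr (phi_half i)).
- move=> i j l; exact: (polar_half_triangle_free ns (phi_half i) (phi_half j) (phi_half l)).
- by move=> x s; apply: polar_q_form; rewrite ?expn_gt0.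
Qed.

(** * Balancing *)

From mathcomp Require Import classical_sets.

Lemma bernoulli_le (R : realFieldType) (x : R) n : 0 <= x -> 1 + x *+ n <= (1 + x) ^+ n.
Proof.
move=> x0; elim: n => [|n IH]; first by rewrite mulr0n addr0 expr0.
rewrite exprS; apply: le_trans (_ : (1 + x) * (1 + x *+ n) <= _).
  rewrite mulrSr mulrDl mul1r mulrDr mulr1 addrA lerD2l lerDl.
  by rewrite mulr_ge0 // mulrn_wge0.
by rewrite ler_wpM2l // addr_ge0.
Qed.

(* [Q s q] says that [q] is the diagonal attached to the scaling [s].  Any [s]
   that nearly maximises prod s_i^2 / (sum (q_i + d s_i^2))^n works: if one term
   exceeded 8 times the mean, halving that [s_i] would increase the quotient by a
   factor 7/4.  The term in [d] keeps the quotient bounded. *)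
Lemma balanced_scaling (R : realType) n (Q : ('I_n -> R) -> ('I_n -> R) -> Prop) (d : R) :
  (0 < n)%N -> 0 < d ->
  (forall s : 'I_n -> R, (forall i, 0 < s i) -> exists q, Q s q) ->
  (forall s q, Q s q -> forall i, 0 <= q i) ->
  (forall (s t q q' : 'I_n -> R), (forall i, 0 < t i) -> Q s q -> Q (fun i => t i * s i) q' ->
     \sum_i q' i <= \sum_i t i ^+ 2 * q i) ->
  exists s q : 'I_n -> R, [/\ forall i, 0 < s i, Q s q &
    forall i, n%:R * (q i + d * s i ^+ 2) <= 8%:R * \sum_j (q j + d * s j ^+ 2)].
Proof.
move=> n_gt0 d_gt0 Q_total Q_ge0 Q_mono.
pose h (s q : 'I_n -> R) := \sum_j (q j + d * s j ^+ 2).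
pose f s q := (\prod_i s i ^+ 2) / h s q ^+ n.
pose E : set R := fun x => exists s q : 'I_n -> R, [/\ forall i, 0 < s i, Q s q & x = f s q].
have h_ge (s q : 'I_n -> R) i : (forall i, 0 < s i) -> Q s q -> d * s i ^+ 2 <= h s q.
  move=> s_gt0 Qsq; rewrite /h (bigD1 i) //= -[X in X <= _]addr0 lerD //.
    by rewrite lerDr (Q_ge0 s).
  apply: sumr_ge0 => j _; rewrite addr_ge0 ?(Q_ge0 s) //.
  by rewrite mulr_ge0 ?ltW // exprn_gt0.
have h_gt0 (s q : 'I_n -> R) : (forall i, 0 < s i) -> Q s q -> 0 < h s q.
  move=> s_gt0 Qsq; apply: lt_le_trans (h_ge s q (Ordinal n_gt0) s_gt0 Qsq).
  by rewrite mulr_gt0 ?exprn_gt0.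
have f_gt0 (s q : 'I_n -> R) : (forall i, 0 < s i) -> Q s q -> 0 < f s q.
  move=> s_gt0 Qsq; rewrite divr_gt0 ?exprn_gt0 ?h_gt0 //.
  by apply: prodr_gt0 => i _; rewrite exprn_gt0.
(* Each s_i^2 is at most h / d, so the product is at most (h / d)^n. *)
have E_bound : ubound E (d ^- n).
  move=> _ [s [q [s_gt0 Qsq ->]]]; rewrite ler_pdivrMr ?exprn_gt0 ?h_gt0 //.
  rewrite -exprVn -exprMn -[X in _ ^+ X]card_ord -prodr_const.
  apply: ler_prod => i _; rewrite exprn_ge0 ?(ltW (s_gt0 i)) //=.
  by rewrite mulrC ler_pdivlMr // mulrC h_ge.
have [q1 Q1] := Q_total (fun=> 1) (fun=> ltr01).
have E1 : E (f (fun=> 1) q1) by exists (fun=> 1), q1.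
have supE : has_sup E by split; [exists (f (fun=> 1) q1) | exists (d ^- n)].
have sup_gt0 : 0 < sup E.
  by apply: lt_le_trans (f_gt0 _ _ _ Q1) _ => //; apply: sup_upper_bound.
(* The chosen value exceeds 4/7 of the supremum, so no scaling can gain a factor 7/4. *)
have [|_ [s [q [s_gt0 Qsq ->]]] near_sup] := @sup_adherent _ E (3%:R / 7%:R * sup E) _ supE.
  by rewrite mulr_gt0 // divr_gt0.
exists s, q; split=> // i; rewrite leNgt -/(h s q); apply/negP => unbalanced.
(* Halving s_i divides the product by 4 and takes at least 3/4 of the i-th term off h. That term
   exceeds 8h / n, so h drops by at least 6h / n. *)
pose t (j : 'I_n) : R := if j == i then 2^-1 else 1.
have t_gt0 j : 0 < t j by rewrite /t; case: ifP => _; rewrite ?invr_gt0.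
have ts_gt0 j : 0 < t j * s j by rewrite mulr_gt0.
have [q' Q'] := Q_total _ ts_gt0.
pose h' := h (fun j => t j * s j) q'.
have n0 : 0 < n%:R :> R by rewrite ltr0n.
have h'_le : h' <= h s q - 6%:R / n%:R * h s q.
  have h'_c : h' <= h s q - 3%:R / 4%:R * (q i + d * s i ^+ 2).
    apply: le_trans (_ : \sum_j t j ^+ 2 * (q j + d * s j ^+ 2) <= _).
      rewrite /h' /h big_split /= [X in _ <= X](eq_bigr
        (fun j => t j ^+ 2 * q j + d * (t j * s j) ^+ 2)); last first.
        by move=> j _; rewrite mulrDr exprMn; ring.
      by rewrite big_split lerD2r (Q_mono s).
    rewrite /h (bigD1 i) //= [X in _ <= X - _](bigD1 i) //= {1}/t eqxx.
    rewrite [X in _ + X <= _](eq_bigr (fun j => q j + d * s j ^+ 2)); last first.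
      by move=> j /negPf ji; rewrite /t ji expr1n mul1r.
    by rewrite le_eqVlt; apply/orP; left; apply/eqP; field.
  apply: le_trans h'_c _; rewrite lerD2l lerN2.
  rewrite mulrAC ler_pdivrMr //; move/ltW: unbalanced; lra.
have h'_gt0 : 0 < h' by apply: h_gt0.
have h0 := h_gt0 _ _ s_gt0 Qsq.
have h'_h : (1 + 6%:R / n%:R) * h' <= h s q.
  set x := 6%:R / n%:R in h'_le *; have x0 : 0 < x by rewrite divr_gt0.
  apply: le_trans (_ : (1 + x) * (h s q - x * h s q) <= _).
    by rewrite ler_pM2l // addr_gt0.
  have : 0 <= x * (x * h s q) by exact: (mulr_ge0 (ltW x0) (mulr_ge0 (ltW x0) (ltW h0))).
  lra.
(* By Bernoulli, (1 + 6/n)^n >= 7; together with the factor 1/4 of the product this is the gain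
   7/4. *)
have seven : 7%:R * h' ^+ n <= h s q ^+ n.
  apply: le_trans (_ : (1 + 6%:R / n%:R) ^+ n * h' ^+ n <= _).
    rewrite ler_pM2r ?exprn_gt0 //; apply: le_trans (bernoulli_le _ _); last first.
      by rewrite divr_ge0.
    by rewrite -[_ *+ n]mulr_natr divfK ?gt_eqF // -[7%:R]/((1 + 6)%:R) natrD.
  by rewrite -exprMn lerXn2r // nnegrE ltW // mulr_gt0 // addr_gt0 // divr_gt0.
have f'_le : f (fun j => t j * s j) q' <= sup E.
  by apply: sup_upper_bound => //; exists (fun j => t j * s j), q'.
have prod_t : \prod_j (t j * s j) ^+ 2 = 4%:R^-1 * \prod_j s j ^+ 2.
  under eq_bigr => j _ do rewrite exprMn.
  rewrite big_split /=; congr (_ * _); rewrite (bigD1 i) //= big1 => [|j /negPf ji].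
    by rewrite /t eqxx; field.
  by rewrite /t ji expr1n.
move: f'_le near_sup; rewrite /f -/h' prod_t.
rewrite ler_pdivrMr ?exprn_gt0 // ltr_pdivlMr ?exprn_gt0 //.
set p := \prod_j _ => f'_le near_sup.
have : sup E * (7%:R * h' ^+ n) <= sup E * h s q ^+ n by rewrite ler_pM2l.
lra.
Qed.

(** * Inertia of Hermitian matrices *)

Section Inertia.
Local Open Scope sesquilinear_scope.
Local Notation R := Rdefinitions.R.
Local Notation "x %:C" := (real_complex R x).

Lemma conjC_RtoC (x : R) : (x%:C)^* = x%:C :> C.
Proof. by apply: conj_Creal; apply/complex_realP; exists x. Qed.

(** The eigenvectors are the conjugated rows of [U]; the eigenvalues are stored as reals so that
    they can be compared in [R]. *)
Definition spectral n (M U : 'M[C]_n) (lam : 'I_n -> R) : Prop :=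
  U \is unitarymx /\ M = U^t* *m diag_mx (\row_l (lam l)%:C) *m U.

Lemma spectralE n (M U : 'M[C]_n) lam i j : spectral M U lam ->
  M i j = \sum_l (lam l)%:C * ((U l i)^* * U l j).
Proof.
move=> [_ ->]; rewrite mul_mx_diag mxE; apply: eq_bigr => l _.
by rewrite !mxE; ring.
Qed.

Lemma unitary_col n (U : 'M[C]_n) i j : U \is unitarymx ->
  \sum_l (U l i)^* * U l j = (i == j)%:R.
Proof.
rewrite -trmxC_unitary => /unitarymxP/matrixP/(_ i j); rewrite trmxCK !mxE => <-.
by apply: eq_bigr => l _; rewrite !mxE.
Qed.

Lemma unitary_row n (U : 'M[C]_n) l m : U \is unitarymx ->
  \sum_i U l i * (U m i)^* = (l == m)%:R.
Proof.
move=> /unitarymxP/matrixP/(_ l m); rewrite !mxE => <-.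
by apply: eq_bigr => i _; rewrite !mxE.
Qed.

Lemma hermitian_spectral n (M : 'M[C]_n) : Defs.hermitian M -> exists U lam, spectral M U lam.
Proof.
move=> hM; have herm : M \is hermsymmx.
  by rewrite is_hermitianmxE expr0 scale1r {1}hM map_trmx.
have /orthomx_spectralP ME := hermitian_normalmx herm.
have U_unitary := spectral_unitarymx M.
have /mxOverP real_diag := hermitian_spectral_diag_real herm.
exists (spectralmx M), (fun l => complex.Re (spectral_diag M 0 l)); split=> //.
rewrite {1}ME invmx_unitary //; congr (_ *m diag_mx _ *m _).
by apply/rowP => l; rewrite mxE; apply/esym/RRe_real.
Qed.

Lemma char_poly_conj (K : comNzRingType) n (V D U : 'M[K]_n) : V *m U = 1%:M ->
  char_poly (V *m D *m U) = char_poly D.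
Proof.
move=> VU; pose c := map_mx (@polyC K).
have cVU : c _ _ V *m c _ _ U = 1%:M by rewrite /c -map_mxM VU map_mx1.
rewrite /char_poly.
have -> : char_poly_mx (V *m D *m U) = c _ _ V *m char_poly_mx D *m c _ _ U.
  rewrite /char_poly_mx mulmxBr mulmxBl -/c /c !map_mxM; congr (_ - _).
  by rewrite scalar_mxC -mulmxA cVU mulmx1.
by rewrite !det_mulmx mulrAC -det_mulmx cVU det1 mul1r.
Qed.

(** The characteristic polynomial splits with roots [lam l], so the root list used by [n_ge0_mx] is
    a permutation of them. *)
Lemma n_ge0_spectral n (A U : 'M[C]_n) lam : spectral A U lam ->
  n_ge0_mx A = #|[set l | 0 <= lam l]|.
Proof.
move=> [U_unitary AE].
have UU : U^t* *m U = 1%:M.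
  by apply/matrixP => i j; rewrite !mxE -(unitary_col i j U_unitary); apply: eq_bigr => l _; rewrite !mxE.
have char : char_poly A = \prod_l ('X - ((lam l)%:C)%:P).
  rewrite AE; set D := diag_mx _.
  have -> : char_poly (U^t* *m D *m U) = char_poly D.
    exact: char_poly_conj.
  rewrite char_poly_trig ?diag_mx_is_trig //.
  by apply: eq_bigr => l _; rewrite !mxE eqxx mulr1n.
rewrite /n_ge0_mx /eigenvalues; case: closed_field_poly_normal => rs /= E.
have : perm_eq rs [seq (lam l)%:C | l <- enum 'I_n].
  apply: prod_XsubC_eq; rewrite big_map big_enum /= -char E.
  by rewrite (monicP (char_poly_monic A)) scale1r.
move/seq.permP => ->; rewrite count_map -sum1_count big_enum_cond /= sum1dep_card.
by congr #|pred_of_set _|; apply/setP => l; rewrite !inE /= ler0c.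
Qed.

(** Dimension count: were the m-dimensional row space of [B] larger than the number of nonnegative
    eigenvalues, it would contain a nonzero vector orthogonal to all their eigenvectors, where the
    form is negative. *)
Lemma subspace_le_n_ge0 n m (A : 'M[C]_n) (B : 'M[C]_(m, n)) : Defs.hermitian A ->
  (forall c : 'rV_m, c *m B = 0 -> c = 0) ->
  (forall c : 'rV_m, 0 <= (c *m B *m A *m (c *m B)^t*) 0 0) ->
  (m <= n_ge0_mx A)%N.
Proof.
move=> /hermitian_spectral [U [lam sp]] B_inj B_ge0; have [U_unitary AE] := sp.
rewrite (n_ge0_spectral sp); set Z := [set l | _]; rewrite leqNgt; apply/negP => Zm.
pose V := B *m U^t* *m \matrix_(l, j) (l == enum_val j :> 'I_n)%:R : 'M_(m, #|Z|).
have /rowV0Pn [c /sub_kermxP cV c0] : kermx V != 0.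
  rewrite -mxrank_eq0 mxrank_ker -lt0n subn_gt0.
  exact: leq_ltn_trans (rank_leq_col _) Zm.
have [y yE] : {y | y = c *m B *m U^t*} by exists (c *m B *m U^t*).
have y0 l : l \in Z -> y 0 l = 0.
  move=> lZ; have /rowP/(_ (enum_rank_in lZ l)) := cV.
  rewrite /V !mulmxA -yE mxE [RHS]mxE (bigD1 l) //= mxE enum_rankK_in // eqxx mulr1.
  rewrite big1 ?addr0 // => k kl.
  by rewrite mxE enum_rankK_in // (negPf kl) mulr0.
(* The row [y] holds the coordinates of [c *m B] in the eigenbasis, and it vanishes on [Z]. *)
have yU : y *m U = c *m B by rewrite yE mulmxKtV.
have form : (c *m B *m A *m (c *m B)^t*) 0 0 = \sum_l (lam l)%:C * (y 0 l * (y 0 l)^*).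
  rewrite AE !mulmxA -yE -[in (c *m B)^t*]yU trmx_mul map_mxM.
  rewrite mulmxA mulmxtVK // mul_mx_diag mxE.
  by apply: eq_bigr => l _; rewrite !mxE; ring.
have term_le0 l : (lam l)%:C * (y 0 l * (y 0 l)^*) <= 0.
  have [/y0 ->|] := boolP (l \in Z); first by rewrite mul0r mulr0.
  rewrite inE -ltNge => lam_lt0; rewrite -normCK.
  by rewrite mulr_le0_ge0 ?exprn_ge0 // -[0]/((0:R)%:C) lecR ltW.
have sum0 : \sum_l - ((lam l)%:C * (y 0 l * (y 0 l)^*)) = 0.
  apply/eqP; rewrite eq_le sumr_ge0 => [|l _]; last by rewrite oppr_ge0.
  by rewrite andbT sumrN oppr_le0 -form.
case/eqP: c0; apply: B_inj; rewrite -yU.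
suff -> : y = 0 by rewrite mul0mx.
apply/rowP => l; rewrite [RHS]mxE.
have [/y0 //|] := boolP (l \in Z); rewrite inE -ltNge => lam_lt0.
have : - ((lam l)%:C * (y 0 l * (y 0 l)^*)) = 0.
  by apply: (psumr_eq0P _ sum0) => // k _; rewrite oppr_ge0.
move/eqP; rewrite oppr_eq0 -normCK mulf_eq0 expf_eq0 normr_eq0 /=.
by rewrite -[0]/((0:R)%:C) (inj_eq (@complexI _)) lt_eqF //= => /eqP.
Qed.

(** The form of [A] vanishes on the coordinate subspace of [T]. *)
Lemma zero_block_le_n_ge0 n (A : 'M[C]_n) (T : {set 'I_n}) : Defs.hermitian A ->
  (forall i j, i \in T -> j \in T -> A i j = 0) -> (#|T| <= n_ge0_mx A)%N.
Proof.
move=> hA A0; pose B : 'M[C]_(#|T|, n) := \matrix_(a, i) (i == enum_val a)%:R.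
apply: (@subspace_le_n_ge0 _ _ _ B) => // [c cB|c].
  apply/rowP => a; have /rowP/(_ (enum_val a)) := cB.
  rewrite !mxE (bigD1 a) //= mxE eqxx mulr1 big1 ?addr0 // => b ba.
  by rewrite mxE (inj_eq enum_val_inj) eq_sym (negPf ba) mulr0.
have BA a i : (B *m A) a i = A (enum_val a) i.
  rewrite mxE (bigD1 (enum_val a)) //= mxE eqxx mul1r big1 ?addr0 // => k ka.
  by rewrite mxE (negPf ka) mul0r.
have BAB a b : (B *m A *m B^t*) a b = 0.
  rewrite mxE big1 // => i _; rewrite BA !mxE; case: eqP => [->|_].
    by rewrite A0 ?enum_valP // mul0r.
  by rewrite rmorph0 mulr0.
rewrite trmx_mul map_mxM !mulmxA -!(mulmxA c) mulmxA.
suff -> : B *m A *m B^t* = 0 by rewrite mulmx0 mul0mx mxE.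
by apply/matrixP => a b; rewrite BAB mxE.
Qed.

(** One direction of Sylvester's law of inertia: D maps the span of the positive eigenvectors of D A
    D injectively to a space on which the form of [A] is nonnegative. *)
Lemma scaled_pos_le_n_ge0 n (A U : 'M[C]_n) (s lam : 'I_n -> R) :
  Defs.hermitian A -> (forall i, 0 < s i) ->
  spectral (\matrix_(i, j) ((s i)%:C * (s j)%:C * A i j)) U lam ->
  (#|[set l | (0 < lam l)%R]| <= n_ge0_mx A)%N.
Proof.
move=> hA s_gt0; set M := \matrix_(i, j) _ => -[U_unitary ME].
set Z := [set l | _]; pose D := diag_mx (\row_i (s i)%:C).
have ADM : D *m A *m D = M.
  apply/matrixP => i j; rewrite mul_mx_diag mul_diag_mx !mxE; ring.
have DT : D^t* = D.
  by rewrite tr_diag_mx map_diag_mx; congr diag_mx; apply/rowP => i; rewrite !mxE; apply: conjC_RtoC.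
pose W : 'M[C]_(#|Z|, n) := \matrix_(a, l) (l == enum_val a)%:R.
have D_unit : D \in unitmx.
  rewrite unitmxE det_diag unitfE; apply/prodf_neq0 => i _; rewrite mxE.
  by rewrite -[0]/((0:R)%:C) (inj_eq (@complexI _)) gt_eqF.
apply: (@subspace_le_n_ge0 _ _ _ (W *m U *m D)) => // [c|c].
  move=> /(congr1 (mulmx^~ (invmx D))); rewrite !mulmxA mulmxK // mul0mx.
  move=> /(congr1 (mulmx^~ (invmx U))); rewrite mulmxK ?unitarymx_unit // mul0mx.
  move=> cW; apply/rowP => a; have /rowP/(_ (enum_val a)) := cW.
  rewrite !mxE (bigD1 a) //= mxE eqxx mulr1 big1 ?addr0 // => b ba.
  by rewrite mxE (inj_eq enum_val_inj) eq_sym (negPf ba) mulr0.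
rewrite !mulmxA trmx_mul map_mxM DT mulmxA -(mulmxA _ D A) -(mulmxA _ _ D) ADM.
rewrite ME trmx_mul map_mxM !mulmxA !mulmxtVK //.
rewrite mul_mx_diag mxE; apply: sumr_ge0 => l _; rewrite !mxE.
have [lZ|lZ] := boolP (l \in Z); last first.
  rewrite big1 ?mul0r // => a _; rewrite mxE; case: eqP => [E|_]; last by rewrite mulr0.
  by move: lZ; rewrite E enum_valP.
rewrite mulrAC -normCK mulr_ge0 ?exprn_ge0 // ler0c.
by move: lZ; rewrite inE => /ltW.
Qed.

(** * Weighted Gram matrices and their Schur products *)

Definition sqnorm (z : C) : R := complex.Re z ^+ 2 + complex.Im z ^+ 2.

Lemma sqnormE z : (sqnorm z)%:C = z * z^*.
Proof. by rewrite /sqnorm add_Re2_Im2 normCK. Qed.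

Lemma sqnorm_ge0 z : 0 <= sqnorm z.
Proof. by rewrite addr_ge0 ?sqr_ge0. Qed.

(** The entries of U^* diag(c) U, a positive semidefinite matrix when [c] is nonnegative. *)
Definition gram n (U : 'M[C]_n) (c : 'I_n -> R) (i j : 'I_n) : C :=
  \sum_l (c l)%:C * ((U l i)^* * U l j).

Definition gram_diag n (U : 'M[C]_n) (c : 'I_n -> R) (i : 'I_n) : R :=
  \sum_l c l * sqnorm (U l i).

Lemma gram_diagE n (U : 'M[C]_n) c i : gram U c i i = (gram_diag U c i)%:C.
Proof.
rewrite /gram_diag rmorph_sum; apply: eq_bigr => l _.
by rewrite rmorphM /= sqnormE [X in _ * X]mulrC.
Qed.

Lemma gram_diag_ge0 n (U : 'M[C]_n) c i : (forall l, 0 <= c l) -> 0 <= gram_diag U c i.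
Proof. by move=> c0; apply: sumr_ge0 => l _; rewrite mulr_ge0 ?sqnorm_ge0. Qed.

Lemma sum_gram_diag n (U : 'M[C]_n) c : U \is unitarymx ->
  \sum_i gram_diag U c i = \sum_l c l.
Proof.
move=> U_unitary; rewrite exchange_big /=; apply: eq_bigr => l _.
rewrite -mulr_sumr; apply: (@complexI R); rewrite rmorphM rmorph_sum /=.
under eq_bigr => i _ do rewrite sqnormE.
by rewrite (unitary_row l l U_unitary) eqxx mulr1.
Qed.

(* The Schur product of two rank one Gram matrices has rank one. *)
Lemma gram_kernel n (U : 'M[C]_n) (c d : 'I_n -> R) (K : 'I_n -> 'I_n -> C) :
  \sum_i \sum_j K i j * (gram U c i j * gram U d j i)
  = \sum_l \sum_m (c l * d m)%:C *
      \sum_i \sum_j K i j * ((U l i * (U m i)^*)^* * (U l j * (U m j)^*)).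
Proof.
transitivity (\sum_i \sum_j \sum_l \sum_m (c l * d m)%:C *
   (K i j * ((U l i * (U m i)^*)^* * (U l j * (U m j)^*)))).
  apply: eq_bigr => i _; apply: eq_bigr => j _.
  rewrite /gram mulr_suml mulr_sumr; apply: eq_bigr => l _.
  rewrite mulr_sumr mulr_sumr; apply: eq_bigr => m _.
  by rewrite !rmorphM /= conjCK; ring.
under eq_bigr => i _ do rewrite exchange_big /=.
rewrite exchange_big /=; apply: eq_bigr => l _.
under eq_bigr => i _ do rewrite exchange_big /=.
rewrite exchange_big /=; apply: eq_bigr => m _.
by rewrite mulr_sumr; apply: eq_bigr => i _; rewrite mulr_sumr.
Qed.

(** Take the kernel 1 in [gram_kernel]: the inner sums are |<u_l, u_m>|^2, which is 1 or 0 by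
    orthonormality. *)
Lemma gram_trace n (U : 'M[C]_n) (c d : 'I_n -> R) : U \is unitarymx ->
  \sum_i \sum_j gram U c i j * gram U d j i = (\sum_l c l * d l)%:C.
Proof.
move=> U_unitary.
transitivity (\sum_i \sum_j 1 * (gram U c i j * gram U d j i)).
  by apply: eq_bigr => i _; apply: eq_bigr => j _; rewrite mul1r.
rewrite gram_kernel rmorph_sum; apply: eq_bigr => l _.
have dot m : \sum_i \sum_j 1 * ((U l i * (U m i)^*)^* * (U l j * (U m j)^*))
    = (l == m)%:R^* * (l == m)%:R.
  rewrite -(unitary_row l m U_unitary) rmorph_sum mulr_suml.
  apply: eq_bigr => i _; rewrite mulr_sumr.
  by apply: eq_bigr => j _; rewrite mul1r.
rewrite (bigD1 l) //= dot eqxx rmorph1 !mulr1 big1 ?addr0 // => m ml.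
by rewrite dot eq_sym (negPf ml) !mulr0.
Qed.

(** The Schur product is a nonnegative combination of rank one matrices x x^*, so a bound on the
    form of [K] sums up to one in terms of the diagonals. *)
Lemma gram_kernel_le n (U : 'M[C]_n) (c d : 'I_n -> R) (K : 'I_n -> 'I_n -> C)
    (r : nat) (e : C) :
  (forall l, 0 <= c l) -> (forall l, 0 <= d l) ->
  (forall x : 'I_n -> C, e * (\sum_i \sum_j K i j * ((x i)^* * x j))
     <= r%:R * \sum_i (x i)^* * x i) ->
  e * (\sum_i \sum_j K i j * (gram U c i j * gram U d j i))
  <= (r%:R * \sum_i gram_diag U c i * gram_diag U d i)%:C.
Proof.
move=> c0 d0 K_form; rewrite gram_kernel.
apply: le_trans (_ : \sum_l \sum_m (c l * d m)%:C *
    (r%:R * \sum_i (U l i * (U m i)^*)^* * (U l i * (U m i)^*)) <= _).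
  rewrite mulr_sumr; apply: ler_sum => l _; rewrite mulr_sumr.
  apply: ler_sum => m _; rewrite mulrCA ler_wpM2l ?K_form //.
  by rewrite ler0c mulr_ge0.
rewrite mulr_sumr rmorph_sum le_eqVlt; apply/orP; left; apply/eqP.
transitivity (\sum_l \sum_m \sum_i r%:R * ((c l)%:C * (sqnorm (U l i))%:C *
   ((d m)%:C * (sqnorm (U m i))%:C))).
  apply: eq_bigr => l _; apply: eq_bigr => m _; rewrite mulrCA !mulr_sumr.
  apply: eq_bigr => i _.
  by rewrite !rmorphM /= conjCK !sqnormE; ring.
under eq_bigr => l _ do rewrite exchange_big /=.
rewrite exchange_big /=; refine (@eq_bigr C 0 +%R _ _ _ _ _ _) => i _.
rewrite !rmorphM rmorph_nat !rmorph_sum mulr_suml mulr_sumr; apply: eq_bigr => l _.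
rewrite !mulr_sumr; apply: eq_bigr => m _.
by rewrite !rmorphM.
Qed.

(** * Positive and negative parts of a Hermitian matrix *)

Definition pos_part n (lam : 'I_n -> R) l := Num.max (lam l) 0.
Definition neg_part n (lam : 'I_n -> R) l := Num.max (- lam l) 0.

Lemma spectral_pos_neg n (M U : 'M[C]_n) lam i j : spectral M U lam ->
  M i j = gram U (pos_part lam) i j - gram U (neg_part lam) i j.
Proof.
move=> sp; rewrite (spectralE i j sp) /gram -sumrB; apply: eq_bigr => l _.
rewrite -mulrBl -rmorphB; congr (_%:C * _).
by rewrite /pos_part /neg_part; case: (lerP (lam l) 0); case: (lerP (- lam l) 0); lra.
Qed.

(** Where M vanishes, P and N agree, so the sums of N_ij P_ji and P_ij P_ji over H coincide.
    Bounding the first above and the second below gives tr(P^2) / q <= 2r sum_i P_ii^2. *)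
Lemma pos_eigenvalue_sum_sq_le n (M U : 'M[C]_n) lam (H : rel 'I_n) (r : nat) :
  (0 < r)%N -> spectral M U lam ->
  (forall i, M i i = 0) -> (forall i j, H i j -> M i j = 0) ->
  (forall (x : 'I_n -> C) (s : bool),
    (-1) ^+ s * (\sum_i \sum_j ((H i j)%:R - (r%:R ^+ 2)^-1) * ((x i)^* * x j))
    <= r%:R * \sum_i (x i)^* * x i) ->
  \sum_l pos_part lam l ^+ 2
    <= 2%:R * r%:R ^+ 3 * \sum_i gram_diag U (pos_part lam) i ^+ 2.
Proof.
move=> r_gt0 sp M0 MH form; have [U_unitary _] := sp.
pose c := pos_part lam; pose d := neg_part lam.
have c0 l : 0 <= c l by rewrite /c /pos_part le_max lexx orbT.
have d0 l : 0 <= d l by rewrite /d /neg_part le_max lexx orbT.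
pose q : C := (r%:R ^+ 2)^-1.
pose hN := \sum_i \sum_j (H i j)%:R * (gram U d i j * gram U c j i).
pose hP := \sum_i \sum_j (H i j)%:R * (gram U c i j * gram U c j i).
have offE i j : M i j = 0 -> gram U d i j = gram U c i j.
  by rewrite (spectral_pos_neg i j sp) => /eqP; rewrite subr_eq0 => /eqP.
have hE : hN = hP.
  apply: eq_bigr => i _; apply: eq_bigr => j _; case: (boolP (H i j)) => [Hij|_]; last by rewrite !mul0r.
  by rewrite offE ?MH.
have split_form a b : \sum_i \sum_j ((H i j)%:R - q) * (gram U a i j * gram U b j i)
   = \sum_i \sum_j (H i j)%:R * (gram U a i j * gram U b j i) - q * (\sum_l a l * b l)%:C.
  rewrite -(gram_trace a b U_unitary) mulr_sumr -sumrB; apply: eq_bigr => i _.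
  by rewrite mulr_sumr -sumrB; apply: eq_bigr => j _; rewrite mulrBl.
(* The sign +1 is used for the pair (N, P), whose trace tr(NP) vanishes, and the sign -1 for (P,
   P). *)
have := gram_kernel_le U d0 c0 (fun x => form x false).
have := gram_kernel_le U c0 c0 (fun x => form x true).
rewrite !split_form -/hN -/hP hE expr1 expr0 mul1r mulN1r.
have -> : \sum_l d l * c l = 0.
  by apply: big1 => l _; rewrite /d /c /pos_part /neg_part; case: (lerP (lam l) 0); case: (lerP (- lam l) 0); rewrite ?mul0r ?mulr0 //; lra.
rewrite rmorph0 mulr0 subr0 opprB => hP_le hN_le.
have := lerD hP_le hN_le; rewrite subrK -rmorphD.
have -> : \sum_i gram_diag U d i * gram_diag U c i = \sum_i gram_diag U c i * gram_diag U c i.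
  by apply: eq_bigr => i _; congr (_ * _); apply: (@complexI R); rewrite -!gram_diagE offE.
have -> : q = ((r%:R ^+ 2)^-1 : R)%:C by rewrite fmorphV rmorphXn rmorph_nat.
rewrite -rmorphM lecR mulrC ler_pdivrMr ?exprn_gt0 ?ltr0n // => le_sum.
rewrite (eq_bigr (fun l => c l * c l)) => [|l _]; last by rewrite expr2.
apply: le_trans le_sum _; rewrite le_eqVlt; apply/orP; left; apply/eqP.
by under [in RHS]eq_bigr => i _ do rewrite expr2; ring.
Qed.

(** The diagonal of |M| = P + N. *)
Definition abs_diag n (U : 'M[C]_n) (lam : 'I_n -> R) := gram_diag U (fun l => `|lam l|).

(* If M = P - N then TMT = TPT - TNT, so its trace norm is at most tr T(P + N)T. *)
Lemma trace_norm_scaling n (M U M' V : 'M[C]_n) (lam mu t : 'I_n -> R) :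
  spectral M U lam -> spectral M' V mu ->
  (forall i j, M' i j = (t i)%:C * (t j)%:C * M i j) ->
  \sum_i abs_diag V mu i <= \sum_i t i ^+ 2 * abs_diag U lam i.
Proof.
move=> [U_unitary ME] [V_unitary M'E] M't.
pose D : 'M[C]_n := diag_mx (\row_i (t i)%:C).
have DT : D^t* = D.
  by rewrite tr_diag_mx map_diag_mx; congr diag_mx; apply/rowP => i; rewrite !mxE; apply: conjC_RtoC.
have [Z ZE] : {Z : 'M[C]_n | Z = V *m D *m U^t*} by exists (V *m D *m U^t*).
have ZT : Z^t* = U *m D *m V^t*.
  by rewrite ZE !trmx_mul !map_mxM DT trmxCK !mulmxA.
have diag_mu : diag_mx (\row_m (mu m)%:C) = Z *m diag_mx (\row_l (lam l)%:C) *m Z^t*.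
  have -> : diag_mx (\row_m (mu m)%:C) = V *m M' *m V^t*.
    by rewrite M'E !mulmxA (unitarymxP V_unitary) mul1mx mulmxtVK.
  have -> : M' = D *m M *m D.
    by apply/matrixP => i j; rewrite mul_mx_diag mul_diag_mx !mxE M't; ring.
  by rewrite ZT ZE ME !mulmxA.
(* Hence |mu_m| <= sum_l |lam_l| |Z_ml|^2, and the column sums of |Z_ml|^2 are the diagonal entries
   of Z^* Z = U D^2 U^*. *)
have muE m : mu m = \sum_l lam l * sqnorm (Z m l).
  apply: (@complexI R); have /matrixP/(_ m m) := diag_mu.
  rewrite mxE eqxx mulr1n mxE => ->; rewrite mul_mx_diag mxE rmorph_sum.
  by apply: eq_bigr => l _; rewrite !mxE rmorphM /= sqnormE; ring.
have col_Z l : \sum_m sqnorm (Z m l) = \sum_i t i ^+ 2 * sqnorm (U l i).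
  apply: (@complexI R); rewrite !rmorph_sum /=.
  have : Z^t* *m Z = U *m D *m (D *m U^t*).
    by rewrite ZT ZE -!mulmxA (mulmxA (V^t*)) (mulmx1C (unitarymxP V_unitary)) mul1mx.
  move=> /matrixP/(_ l l); rewrite !mxE => E.
  rewrite (eq_bigr (fun m => Z^t* l m * Z m l)) => [|m _]; last first.
    by rewrite !mxE sqnormE mulrC.
  rewrite E; apply: eq_bigr => i _.
  by rewrite mul_mx_diag mul_diag_mx !mxE rmorphM rmorphXn /= sqnormE; ring.
rewrite sum_gram_diag //.
apply: le_trans (_ : \sum_m \sum_l `|lam l| * sqnorm (Z m l) <= _).
  apply: ler_sum => m _; rewrite muE; apply: le_trans (ler_norm_sum _ _ _) _.
  by apply: ler_sum => l _; rewrite normrM (ger0_norm (sqnorm_ge0 _)).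
rewrite exchange_big /= le_eqVlt; apply/orP; left; apply/eqP.
under eq_bigr => l _ do rewrite -mulr_sumr col_Z mulr_sumr.
rewrite exchange_big /=; apply: eq_bigr => i _; rewrite /abs_diag /gram_diag mulr_sumr.
by apply: eq_bigr => l _; ring.
Qed.

(** By the triangle inequality and the arithmetic-geometric mean, |M_ij| is at most the average of
    the entries of |M| at (i, i) and (j, j). *)
Lemma spectral_entry_le n (M U : 'M[C]_n) lam i j (b : R) : spectral M U lam ->
  abs_diag U lam i <= b -> abs_diag U lam j <= b -> sqnorm (M i j) <= b ^+ 2.
Proof.
move=> sp qi qj.
have : `|M i j| <= b%:C.
  rewrite (spectralE i j sp); apply: le_trans (ler_norm_sum _ _ _) _.
  apply: le_trans (_ : ((abs_diag U lam i + abs_diag U lam j) / 2%:R)%:C <= _); last first.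
    by rewrite lecR; lra.
  have -> : (abs_diag U lam i + abs_diag U lam j) / 2%:R
     = \sum_l `|lam l| * ((sqnorm (U l i) + sqnorm (U l j)) / 2%:R).
    rewrite /abs_diag /gram_diag -big_split mulr_suml; apply: eq_bigr => l _ /=.
    by rewrite mulrA -mulrDr.
  rewrite rmorph_sum; apply: ler_sum => l _; rewrite rmorphM /= normrM.
  have -> : `|(lam l)%:C| = (`|lam l|)%:C :> C by rewrite normc_def /= expr0n addr0 sqrtr_sqr.
  apply: ler_wpM2l; first by rewrite ler0c.
  rewrite normrM norm_conjC rmorphM rmorphD fmorphV rmorph_nat /= !sqnormE -!normCK.
  rewrite ler_pdivlMr ?ltr0n // -subr_ge0.
  have -> : `|U l i| ^+ 2 + `|U l j| ^+ 2 - `|U l i| * `|U l j| * 2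
     = (`|U l i| - `|U l j|) ^+ 2 by ring.
  by apply: real_exprn_even_ge0 => //; apply: rpredB; apply: normr_real.
move=> Mb; have b0 : 0 <= b by rewrite -ler0c; apply: le_trans Mb.
rewrite -lecR sqnormE -normCK rmorphXn.
by rewrite lerXn2r // nnegrE // ler0c.
Qed.

(** Cauchy-Schwarz on the support, obtained from the sum of the squares (|Z| c_l - S)^2. *)
Lemma sum_sq_le_support (F : realFieldType) (I : finType) (c : I -> F) (k : nat) :
  (forall l, 0 <= c l) -> (#|[set l | (0 < c l)%R]| <= k)%N ->
  (\sum_l c l) ^+ 2 <= k%:R * \sum_l c l ^+ 2.
Proof.
move=> c0; set Z := [set l | _] => Zk.
have supp l : l \notin Z -> c l = 0.
  by rewrite inE -leNgt => cl; apply/eqP; rewrite eq_le cl c0.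
have -> : \sum_l c l = \sum_(l in Z) c l.
  by rewrite [LHS](bigID (mem Z)) /= [X in _ + X]big1 ?addr0 // => l /supp.
have -> : \sum_l c l ^+ 2 = \sum_(l in Z) c l ^+ 2.
  by rewrite [LHS](bigID (mem Z)) /= [X in _ + X]big1 ?addr0 // => l /supp ->; rewrite expr0n.
set S := \sum_(l in Z) c l; set S2 := \sum_(l in Z) _.
have S2_ge0 : 0 <= S2 by apply: sumr_ge0 => l _; rewrite sqr_ge0.
apply: le_trans (_ : #|Z|%:R * S2 <= _); last by rewrite ler_wpM2r // ler_nat.
have [Z0|Z_gt0] := posnP #|Z|.
  rewrite Z0 mul0r /S big1 ?expr0n // => l; move/eqP: Z0; rewrite cards_eq0 => /eqP ->.
  by rewrite inE.
have : 0 <= \sum_(l in Z) (#|Z|%:R * c l - S) ^+ 2.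
  by apply: sumr_ge0 => l _; rewrite sqr_ge0.
rewrite (eq_bigr (fun l => #|Z|%:R ^+ 2 * c l ^+ 2 - 2%:R * #|Z|%:R * S * c l + S ^+ 2));
  last by move=> l _; ring.
rewrite big_split sumrB /= sumr_const -[S ^+ 2 *+ _]mulr_natr -!mulr_sumr -/S -/S2.
have -> : #|Z|%:R ^+ 2 * S2 - 2%:R * #|Z|%:R * S * S + S ^+ 2 * #|Z|%:R
   = #|Z|%:R * (#|Z|%:R * S2 - S ^+ 2) by ring.
by rewrite pmulr_rge0 ?ltr0n // subr_ge0.
Qed.

(** Finitely many nonzero entries are bounded away from 0. The resulting [d] is the regularising
    constant of the balancing, and 1024 = 16 * 8^2 is the loss incurred there. *)
Lemma entry_gap n (A : 'M[C]_n) :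
  exists2 d : R, 0 < d & forall i j, sqnorm (A i j) <= 1024%:R * d ^+ 2 -> A i j = 0.
Proof.
(* Zero entries contribute nothing to [w], since 0^-1 = 0. *)
pose w : R := 1 + \sum_i \sum_j (sqnorm (A i j))^-1.
have term_ge0 i j : 0 <= (sqnorm (A i j))^-1 by rewrite invr_ge0 sqnorm_ge0.
have w1 : 1 <= w by rewrite lerDl; do 2![apply: sumr_ge0 => ? _].
exists (64%:R * w)^-1; first by rewrite invr_gt0; lra.
move=> i j small; have [//|Aij] := eqVneq (A i j) 0.
have N_gt0 : 0 < sqnorm (A i j).
  rewrite lt0r sqnorm_ge0 andbT; apply: contraNneq Aij => N0.
  by have := sqnormE (A i j); rewrite N0 rmorph0 -normCK => /esym/eqP; rewrite expf_eq0 normr_eq0.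
have Nw : (sqnorm (A i j))^-1 <= w.
  rewrite /w (bigD1 i) //= (bigD1 j) //=.
  have := @sumr_ge0 R _ (index_enum _) (fun l => l != j) _ (fun l _ => term_ge0 i l).
  have : 0 <= \sum_(l | l != i) \sum_j (sqnorm (A l j))^-1.
    by do 2![apply: sumr_ge0 => ? _].
  lra.
have : 1 <= sqnorm (A i j) * w.
  by rewrite -ler_pdivrMl // mulr1.
suff : sqnorm (A i j) * w < 1 by move=> /lt_le_trans H /H; rewrite ltxx.
apply: le_lt_trans (_ : 1024%:R * (64%:R * w)^-1 ^+ 2 * w < _).
  by rewrite ler_pM2r //; lra.
have -> : 1024%:R * (64%:R * w)^-1 ^+ 2 * w = (4%:R * w)^-1 by field; lra.
by rewrite invf_lt1; lra.
Qed.

Lemma n_ge0_lower_bound n (A : 'M[C]_n) (H : rel 'I_n) (r : nat) :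
  (0 < n)%N -> (0 < r)%N -> Defs.hermitian A ->
  (forall i, A i i = 0) -> (forall i j, H i j -> A i j = 0) ->
  (forall (x : 'I_n -> C) (s : bool),
    (-1) ^+ s * (\sum_i \sum_j ((H i j)%:R - (r%:R ^+ 2)^-1) * ((x i)^* * x j))
    <= r%:R * \sum_i (x i)^* * x i) ->
  (32 * n_ge0_mx A <= n)%N ->
  (n <= 512 * r ^ 3 * n_ge0_mx A)%N.
Proof.
move=> n_gt0 r_gt0 hA A_diag A_H form; set k := n_ge0_mx A => k_small.
have [d d_gt0 gap] := entry_gap A.
pose scaled (s : 'I_n -> R) : 'M[C]_n := \matrix_(i, j) ((s i)%:C * (s j)%:C * A i j).
pose Q s (q : 'I_n -> R) := exists U lam, spectral (scaled s) U lam /\ q = abs_diag U lam.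
have [|||s [q [s_gt0 [U [lam [sp qE]]] balanced]]] := @balanced_scaling R n Q d n_gt0 d_gt0.
- move=> s _; have hs : Defs.hermitian (scaled s).
    apply/matrixP => i j; rewrite !mxE {1}hA !mxE !rmorphM /=.
    by rewrite !(conjC_RtoC (s _)); ring.
  have [U [lam sp]] := hermitian_spectral hs.
  by exists (abs_diag U lam), U, lam.
- by move=> s q [U [lam [_ ->]]] i; apply: gram_diag_ge0.
- move=> s t q q' _ [U [lam [sp ->]]] [V [mu [sp' ->]]].
  apply: trace_norm_scaling sp sp' _ => i j.
  by rewrite !mxE !rmorphM /=; ring.
have [U_unitary _] := sp.
pose c := pos_part lam; pose p := gram_diag U c.
have c0 l : 0 <= c l by rewrite /c /pos_part le_max lexx orbT.
have p0 i : 0 <= p i by apply: gram_diag_ge0.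
(* The zero diagonal forces P_ii = N_ii, so the diagonal of |M| is 2 P_ii. *)
have qp i : q i = 2%:R * p i.
  have pn : p i = gram_diag U (neg_part lam) i.
    apply: (@complexI R); rewrite -!gram_diagE; apply/eqP.
    by rewrite -subr_eq0 -(spectral_pos_neg i i sp) mxE A_diag mulr0.
  have -> : 2%:R * p i = p i + gram_diag U (neg_part lam) i by rewrite -pn; ring.
  rewrite qE /p /abs_diag /gram_diag -big_split; apply: eq_bigr => l _ /=; rewrite -mulrDl; congr (_ * _).
  rewrite /c /pos_part /neg_part.
  by case: (ler0P (lam l)); case: (lerP (- lam l) 0); lra.
pose e i := d * s i ^+ 2.
set h := \sum_j _ in balanced.
have e0 i : 0 < e i by rewrite mulr_gt0 ?exprn_gt0.
have h_gt0 : 0 < h.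
  rewrite /h (bigD1 (Ordinal n_gt0)) //=; apply: ltr_wpDr.
    by apply: sumr_ge0 => j _; rewrite qp addr_ge0 ?mulr_ge0 // ltW ?e0.
  by rewrite qp ltr_wpDl ?mulr_ge0 // e0.
have N_gt0 : 0 < n%:R :> R by rewrite ltr0n.
have N_neq0 : n%:R != 0 :> R by rewrite gt_eqF.
pose mu := h / n%:R.
have mu_gt0 : 0 < mu by rewrite divr_gt0.
have bal i : 2%:R * p i + e i <= 8%:R * mu.
  by rewrite -qp mulrA ler_pdivlMr // mulrC; apply: balanced.
have hE : h = n%:R * mu by rewrite /mu mulrC divfK.
(* The exceptional rows, where the regularising term is at least a quarter of the mean. For i, j in
   [T], s_i^2 s_j^2 >= mu^2 / (16 d^2), while the scaled entry is at most 8 mu; so |A_ij|^2 <= 1024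
   d^2 and A_ij = 0. *)
pose T := [set i | mu <= 4%:R * e i].
have T_le_k : (#|T| <= k)%N.
  apply: zero_block_le_n_ge0 => // i j; rewrite !inE => iT jT; apply: gap.
  have qi l : abs_diag U lam l <= 8%:R * mu.
    by rewrite -qE qp; have := bal l; have := e0 l; lra.
  have := spectral_entry_le sp (qi i) (qi j).
  have -> : sqnorm (scaled s i j) = s i ^+ 2 * s j ^+ 2 * sqnorm (A i j).
    apply: (@complexI R); rewrite !rmorphM /= !sqnormE !mxE !rmorphM /=.
    by rewrite !(conjC_RtoC (s _)); ring.
  move=> entry; have d2 : 0 < d ^+ 2 by rewrite exprn_gt0.
  have eij : mu ^+ 2 <= 16%:R * (e i * e j).
    have -> : 16%:R * (e i * e j) = (4%:R * e i) * (4%:R * e j) by ring.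
    by rewrite expr2 ler_pM // ltW.
  have : mu ^+ 2 * sqnorm (A i j) <= mu ^+ 2 * (1024%:R * d ^+ 2).
    apply: le_trans (_ : 16%:R * (e i * e j) * sqnorm (A i j) <= _).
      by rewrite ler_wpM2r ?sqnorm_ge0.
    have -> : 16%:R * (e i * e j) * sqnorm (A i j)
      = 16%:R * d ^+ 2 * (s i ^+ 2 * s j ^+ 2 * sqnorm (A i j)) by rewrite /e; ring.
    have -> : mu ^+ 2 * (1024%:R * d ^+ 2) = 16%:R * d ^+ 2 * (8%:R * mu) ^+ 2 by ring.
    by rewrite ler_pM2l // mulr_gt0.
  by rewrite ler_pM2l ?exprn_gt0.
have kN : 32%:R * k%:R <= n%:R :> R by rewrite -natrM ler_nat.
(* The regularising terms add up to at most 8 k mu + n mu / 4 <= h / 2, because 32 k <= n. *)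
have sum_p : h <= 4%:R * \sum_i p i.
  have hp : h = 2%:R * \sum_i p i + \sum_i e i.
    by rewrite mulr_sumr -big_split; apply: eq_bigr => i _; rewrite qp.
  have sum_e : \sum_i e i <= k%:R * (8%:R * mu) + n%:R * (mu / 4%:R).
    rewrite (bigID (mem T)) /= lerD //.
      apply: le_trans (_ : \sum_(i in T) 8%:R * mu <= _).
        by apply: ler_sum => i _; have := bal i; have := p0 i; lra.
      rewrite sumr_const -[_ *+ _]mulr_natl ler_wpM2r ?ler_nat //.
      by rewrite mulr_ge0 // ltW.
    apply: le_trans (_ : \sum_(i < n | i \notin T) mu / 4%:R <= _).
      by apply: ler_sum => i; rewrite inE -ltNge; lra.
    rewrite sumr_const -[_ *+ _]mulr_natl ler_wpM2r ?ler_nat //.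
      by rewrite divr_ge0 // ltW.
    by rewrite -[X in (_ <= X)%N]card_ord max_card.
  have : 32%:R * k%:R * mu <= n%:R * mu by rewrite ler_pM2r.
  lra.
have sum_p2 : \sum_i p i ^+ 2 <= n%:R * (16%:R * mu ^+ 2).
  apply: le_trans (_ : \sum_(i < n) 16%:R * mu ^+ 2 <= _); last first.
    by rewrite sumr_const card_ord -[_ *+ _]mulr_natl.
  apply: ler_sum => i _.
  have -> : 16%:R * mu ^+ 2 = (4%:R * mu) ^+ 2 by ring.
  rewrite lerXn2r ?nnegrE ?p0 //; first by rewrite pmulr_rge0 // ltW.
  by have := bal i; have := e0 i; lra.
have M_diag i : scaled s i i = 0 by rewrite mxE A_diag mulr0.
have M_H i j : H i j -> scaled s i j = 0 by move=> Hij; rewrite mxE A_H ?mulr0.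
have pos_sq := pos_eigenvalue_sum_sq_le r_gt0 sp M_diag M_H form.
have card_pos : (#|[set l | (0 < c l)%R]| <= k)%N.
  have -> : [set l | (0 < c l)%R] = [set l | (0 < lam l)%R].
    by apply/setP => l; rewrite !inE /c /pos_part lt_max ltxx orbF.
  exact: scaled_pos_le_n_ge0 hA s_gt0 sp.
have sq_sum := sum_sq_le_support c0 card_pos.
rewrite -(sum_gram_diag c U_unitary) -/p in sq_sum.
(* Chain h^2 <= 16 tr(P)^2 <= 16 k tr(P^2) with the bound on tr(P^2) and p_i <= 4 mu; the constant
   is 16 * 2 * 16 = 512, and h = n mu. *)
have key : h ^+ 2 <= 16%:R * (k%:R * (2%:R * r%:R ^+ 3 * (n%:R * (16%:R * mu ^+ 2)))).
  apply: le_trans (_ : (4%:R * \sum_i p i) ^+ 2 <= _).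
    rewrite lerXn2r ?nnegrE ?(ltW h_gt0) // pmulr_rge0 //.
    by apply: sumr_ge0 => i _; apply: p0.
  have -> : (4%:R * \sum_i p i) ^+ 2 = 16%:R * (\sum_i p i) ^+ 2 by ring.
  rewrite ler_pM2l ?ltr0n //; apply: le_trans sq_sum _.
  rewrite ler_wpM2l ?ler0n //; apply: le_trans pos_sq _.
  by rewrite ler_wpM2l // mulr_ge0 // exprn_ge0.
rewrite -(ler_nat R) (natrM _ _ k) (natrM _ 512) natrX.
have : n%:R * (n%:R * mu ^+ 2) <= 512%:R * r%:R ^+ 3 * k%:R * (n%:R * mu ^+ 2).
  by move: key; rewrite hE; lra.
by rewrite ler_pM2r // mulr_gt0 ?exprn_gt0.
Qed.

End Inertia.

(** * The complement graph *)

(** Three independent vertices of the complement would form a triangle of [H]. *)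
Lemma alpha_triangle_free_compl n (H : rel 'I_n) :
  (forall i j l, H i j -> H j l -> H i l -> False) ->
  (alpha [rel i j | (i != j) && ~~ H i j] <= 2)%N.
Proof.
move=> H_free; apply/bigmax_leqP => S indep; rewrite leqNgt; apply/negP.
case/card_gt2P => [x [y [z [[xS yS zS] [xy yz zx]]]]].
have H_edge i j : i \in S -> j \in S -> i != j -> H i j.
  move=> iS jS ij; move/forall_inP/(_ i iS)/forall_inP/(_ j jS): indep.
  by rewrite /= ij negbK.
by apply: (H_free x y z); apply: H_edge; rewrite // eq_sym.
Qed.

(** If 32k <= n, raise the bound to the fourth power, insert r^12 <= (b n)^3 and cancel n^3;
    otherwise n < 32k suffices. *)
Lemma quartic_bound (a b n r k : nat) : (0 < n)%N -> (32 <= a)%N -> (0 < b)%N ->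
  (r ^ 4 <= b * n)%N -> ((32 * k <= n)%N -> (n <= a * r ^ 3 * k)%N) ->
  (n <= a ^ 4 * b ^ 3 * k ^ 4)%N.
Proof.
move=> n_gt0 a32 b_gt0 r4 bound.
have [/bound n_le|/ltnW n_le] := leqP (32 * k) n.
  rewrite -(leq_pmul2r (_ : 0 < n ^ 3)%N) ?expn_gt0 ?n_gt0 //.
  have -> : (n * n ^ 3 = n ^ 4)%N by rewrite -expnS.
  apply: leq_trans (_ : (a * r ^ 3 * k) ^ 4 <= _)%N; first by rewrite leq_exp2r.
  have -> : ((a * r ^ 3 * k) ^ 4 = a ^ 4 * k ^ 4 * (r ^ 4) ^ 3)%N by ring.
  have -> : (a ^ 4 * b ^ 3 * k ^ 4 * n ^ 3 = a ^ 4 * k ^ 4 * (b * n) ^ 3)%N by ring.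
  by rewrite leq_mul2l leq_exp2r // r4 orbT.
have k_gt0 : (0 < k)%N.
  by case: k n_le {bound} => // /(leq_trans n_gt0); rewrite muln0.
apply: leq_trans n_le _; apply: leq_mul.
  rewrite -[32%N]muln1 leq_mul ?expn_gt0 ?b_gt0 //.
  apply: (leq_trans a32); rewrite -{1}[a]expn1 leq_pexp2l //.
  exact: leq_trans a32.
by rewrite -{1}[k]expn1 leq_pexp2l.
Qed.

Lemma alpha2_large_n_ge0 : exists K : nat, forall n, (0 < n)%N ->
  exists e : rel 'I_n, [/\ simple_graph e, (alpha e <= 2)%N &
    (n <= K * n_ge0_graph e ^ 4)%N].
Proof.
exists (512 ^ 4 * 324 ^ 3)%N => n n_gt0.
have [r [H [r_gt0 r4 [H_sym H_irr] H_free form]]] := pseudorandom_triangle_free C n_gt0.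
exists [rel i j | (i != j) && ~~ H i j]; split.
- by split=> [i j|i] /=; rewrite ?eqxx // eq_sym H_sym.
- exact: alpha_triangle_free_compl.
rewrite /n_ge0_graph; case: ex_minnP => k /asboolP [A [[hA A_supp] <-]] _.
apply: (quartic_bound n_gt0 _ _ r4) => //; apply: n_ge0_lower_bound form => // [i|i j Hij].
  by apply/eqP; apply: contraT => /A_supp /=; rewrite eqxx.
by apply/eqP; apply: contraT => /A_supp /=; rewrite Hij andbF.
Qed.

(* From the fourth-power bound to real exponents *)
Close Scope ring_scope.
From Stdlib Require Import Reals.

Lemma Rpower_quartic_bound (a x y : R) :
  (0 < a -> 0 < y -> 1 <= x -> x <= a * y ^ 4 ->
  Rpower x (1 / 9) <= Rpower a (1 / 4) * y)%R.
Proof.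
move=> a0 y0 x1 xy.
apply: (Rle_trans _ (Rpower x (1 / 4))); first by apply: Rle_Rpower; Lra.lra.
apply: (Rle_trans _ (Rpower (a * y ^ 4) (1 / 4))); first by apply: Rle_Rpower_l; Lra.lra.
rewrite -Rpower_mult_distr //; last exact: pow_lt.
rewrite -(Rpower_pow 4) // Rpower_mult.
have -> : (INR 4 * (1 / 4) = 1)%R by simpl; Lra.lra.
by rewrite Rpower_1 //; apply: Rle_refl.
Qed.

Theorem theorem1p2 :
  exists c : R, (0 < c)%R /\
    forall n : nat, (0 < n)%N ->
      exists e : rel 'I_n,
        simple_graph e /\ (alpha e <= 2)%N /\
        (c * Rpower (INR n) (1 / 9) <= INR (n_ge0_graph e))%R.
Proof.
have [K bound] := alpha2_large_n_ge0.
exists (/ Rpower (INR K) (1 / 4))%R; split.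
  by apply: Rinv_0_lt_compat; apply: exp_pos.
move=> n n_gt0; have [e [e_simple e_alpha e_bound]] := bound n n_gt0.
exists e; do 2![split=> //].
move: (n_ge0_graph e) e_bound => k nk.
have INR_le m m' : (m <= m')%N -> (INR m <= INR m')%R by move=> /ssrnat.leP; apply: le_INR.
have INR_pos m : (0 < m)%N -> (0 < INR m)%R by move=> /ssrnat.ltP; apply: lt_0_INR.
(* Since 0 < n <= K k^4, both K and k are positive, as the laws of [Rpower] require. *)
have := leq_trans n_gt0 nk; rewrite muln_gt0 expn_gt0 orbF => /andP[/INR_pos K_gt0 /INR_pos k_gt0].
apply: (Rmult_le_reg_l (Rpower (INR K) (1 / 4))); first exact: exp_pos.
rewrite -Rmult_assoc Rinv_r; last by apply: Rgt_not_eq; apply: exp_pos.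
rewrite Rmult_1_l; apply: Rpower_quartic_bound => //; first exact: (INR_le 1).
apply: Rle_trans (INR_le _ _ nk) _.
rewrite !expnS expn0 !mult_INR /=; apply: Req_le; ring.
Qed.
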